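(* Let $P \subseteq \mathbb{Z}^m$ be a rectangle and let $\omega \in \mathbb{Z}_{\geq 0}$. Then $Q_\omega \subseteq_{S,P} Q_{\omega+1}$, where $Q_\omega = \{\mathbf{x} \in \mathbb{Z}^m : \|\mathbf{x}\|_1 \leq \omega\}$.
   Context: $\|\mathbf{x}\|_1 = |x_1| + \cdots + |x_m|$. A rectangle in $\mathbb{Z}^m$ is a set of the form $\mathbb{Z}^m \cap \prod_{i=1}^m [a_i, b_i]$ with integers $a_i \leq b_i$. For a pixel set $P \subseteq \mathbb{Z}^m$ and finite sets $B_1, B_2 \subseteq \mathbb{Z}^m$ containing $\mathbf{0}$, $B_1 \subseteq_{S,P} B_2$ means $B_1 \subseteq B_2$ and both: (+) for every $\mathbf{x} \in P$ and $\mathbf{b}_2 \in B_2$ with $\mathbf{x} + \mathbf{b}_2 \in P$ there is $\mathbf{b}_1 \in B_1$ with $\mathbf{x} + \mathbf{b}_1 \in P$ and $B_1 + (\mathbf{b}_2 - \mathbf{b}_1) \subseteq B_2$; (−) for every $\mathbf{x} \in P$ and $\mathbf{b}_2 \in B_2$ with $\mathbf{x} - \mathbf{b}_2 \in P$ there is $\mathbf{b}_1 \in B_1$ with $\mathbf{x} - \mathbf{b}_1 \in P$ and $B_1 + (\mathbf{b}_2 - \mathbf{b}_1) \subseteq B_2$. Here $A + \mathbf{v} = \{\mathbf{a} + \mathbf{v} : \mathbf{a} \in A\}$. *)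

(* Defs.v *)
From mathcomp Require Import all_boot all_order all_algebra.
From mathcomp Require Import classical_sets cardinality.

Set Implicit Arguments.
Unset Strict Implicit.
Unset Printing Implicit Defensive.

Import Order.TTheory GRing.Theory Num.Theory.
Local Open Scope classical_set_scope.
Local Open Scope ring_scope.

Definition norm1 (m : nat) (x : 'rV[int]_m) : int := \sum_i `|x 0 i|.

Definition Q (m w : nat) : set 'rV[int]_m := [set x | norm1 x <= w%:Z].
Arguments Q : clear implicits.

Definition rectangle (m : nat) (P : set 'rV[int]_m) : Prop :=
  exists a b : 'rV[int]_m, (forall i, a 0 i <= b 0 i) /\
    P = [set x | forall i, a 0 i <= x 0 i <= b 0 i].

Definition translate (m : nat) (A : set 'rV[int]_m) (v : 'rV[int]_m) :
  set 'rV[int]_m := [set a + v | a in A].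

Definition finite_with0 (m : nat) (B : set 'rV[int]_m) : Prop :=
  finite_set B /\ B 0.

Definition subS_plus (m : nat) (P B1 B2 : set 'rV[int]_m) : Prop :=
  forall x b2, P x -> B2 b2 -> P (x + b2) ->
    exists b1, [/\ B1 b1, P (x + b1) & translate B1 (b2 - b1) `<=` B2].

Definition subS_minus (m : nat) (P B1 B2 : set 'rV[int]_m) : Prop :=
  forall x b2, P x -> B2 b2 -> P (x - b2) ->
    exists b1, [/\ B1 b1, P (x - b1) & translate B1 (b2 - b1) `<=` B2].

(* The relation written B1 \subseteq_{S,P} B2.  It is only meaningful between
   finite sets containing the origin; this domain is part of the relation. *)
Definition subS (m : nat) (P B1 B2 : set 'rV[int]_m) : Prop :=
  [/\ finite_with0 B1, finite_with0 B2, B1 `<=` B2,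
      subS_plus P B1 B2 & subS_minus P B1 B2].

(* Main.v *)
Require Import Defs.
From mathcomp Require Import all_boot all_order all_algebra.
From mathcomp Require Import classical_sets cardinality.
From mathcomp Require Import zify.

(** Given [x] and [x + b] in [P], with [b] nonzero, move [b] one step towards
    [0] along a coordinate where it does not vanish.  The result [b1] has
    norm one less than [b], the point [x + b1] stays in [P] because each of its
    coordinates lies between those of [x] and [x + b], and translation by the
    unit step [b - b1] maps [Q w] into [Q w.+1].  Condition (-) is
    condition (+) at [- b], since the balls are symmetric. *)

Import Order.TTheory GRing.Theory Num.Theory.
Local Open Scope classical_set_scope.
Local Open Scope ring_scope.

Lemma norm1N m (x : 'rV[int]_m) : norm1 (- x) = norm1 x.
Proof. by apply: eq_bigr => i _; rewrite mxE normrN. Qed.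

Lemma ler_norm1D m (x y : 'rV[int]_m) : norm1 (x + y) <= norm1 x + norm1 y.
Proof.
by rewrite /norm1 -big_split; apply: ler_sum => i _; rewrite mxE ler_normD.
Qed.

Lemma ler_norm1_coord m (x : 'rV[int]_m) i : `|x 0 i| <= norm1 x.
Proof. by rewrite /norm1 (bigD1 i) //= lerDl sumr_ge0. Qed.

Lemma norm1_delta m (c : int) (i : 'I_m) : norm1 (c *: delta_mx 0 i) = `|c|.
Proof.
rewrite /norm1 (bigD1 i) //= !mxE !eqxx mulr1 big1 ?addr0 // => j ji.
by rewrite !mxE (negPf ji) andbF mulr0 normr0.
Qed.

(** Only the [i]-th term of the sum changes, and a nonzero integer loses exactly 1 in absolute value
    when its sign is subtracted. *)
Lemma norm1_coord_step m (b : 'rV[int]_m) i :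
  b 0 i != 0 -> norm1 (b - Num.sg (b 0 i) *: delta_mx 0 i) = norm1 b - 1.
Proof.
move=> bi; rewrite /norm1 (bigD1 i) //= [in RHS](bigD1 i) //= !mxE !eqxx mulr1.
rewrite (eq_bigr (fun j => `|b 0 j|)) => [|j ji]; last first.
  by rewrite !mxE (negPf ji) andbF mulr0 subr0.
by rewrite addrAC; congr (_ + _); move: (b 0 i) bi; lia.
Qed.

(** The ball lies in the cube of side [[-w, w]], the image under [f] of the finite type of rows over
    ['I_(w + w).+1]. *)
Lemma finite_Q m w : finite_set (Q m w).
Proof.
pose f (A : 'rV['I_(w + w).+1]_m) : 'rV[int]_m :=
  \row_i ((A 0 i : nat)%:Z - w%:Z).
apply: (sub_finite_set (B := f @` setT)); last first.
  exact/finite_image/finite_finset.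
move=> x Qx; exists (\row_i inord (absz (x 0 i + w%:Z))) => //.
apply/rowP => i; rewrite !mxE.
(* This puts [x 0 i + w] between 0 and [w + w], so neither [absz] nor [inord] alters it. *)
have := le_trans (ler_norm1_coord _ x i) Qx => xi.
by rewrite inordK; lia.
Qed.

Lemma sub_Q m w : Q m w `<=` Q m w.+1.
Proof. by move=> x Qx; apply: (le_trans Qx); lia. Qed.

Lemma translate_Q m w (v : 'rV[int]_m) :
  norm1 v <= 1 -> translate (Q m w) v `<=` Q m w.+1.
Proof.
move=> v1 _ [a Qa <-]; apply: (le_trans (ler_norm1D _ _ _)).
by rewrite -addn1 PoszD lerD.
Qed.

Lemma rectangle_step m (P : set 'rV[int]_m) w (x b : 'rV[int]_m) :
  rectangle P -> P x -> Q m w.+1 b -> P (x + b) ->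
  exists b1, [/\ Q m w b1, P (x + b1) & norm1 (b - b1) <= 1].
Proof.
move=> [lo [hi [_ ->]]] Px Qb Pxb.
have norm10 : norm1 (0 : 'rV[int]_m) = 0.
  by rewrite /norm1 big1 // => i _; rewrite mxE.
(* At [b = 0] no coordinate can shrink, but 0 is already in the smaller ball. *)
have [->|/rV0Pn[i bi]] := eqVneq b 0.
  by exists 0; rewrite addr0 subr0 /Q /= norm10.
exists (b - Num.sg (b 0 i) *: delta_mx 0 i); split.
- by move: Qb; rewrite /Q /= norm1_coord_step //; lia.
- move=> j; have := Px j; have := Pxb j; rewrite !mxE /=.
  by have [->|_] := eqVneq j i; lia.
- by rewrite subKr norm1_delta; lia.
Qed.

Theorem theorem2 (m : nat) (P : set 'rV[int]_m) (w : nat) :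
  rectangle P -> subS P (Q m w) (Q m w.+1).
Proof.
move=> rP; have Q0 n : Q m n 0 by rewrite /Q /= /norm1 big1 // => i _; rewrite mxE.
split; [by split; first exact: finite_Q .. | exact: sub_Q | |].
- move=> x b Px Qb Pxb.
  have [b1 [Qb1 Pxb1 bb1]] := rectangle_step _ _ _ _ _ rP Px Qb Pxb.
  by exists b1; split=> //; apply: translate_Q.
- move=> x b Px Qb Pxb.
  have QNb : Q m w.+1 (- b) by rewrite /Q /= norm1N.
  have [b1 [Qb1 Pxb1 bb1]] := rectangle_step _ _ _ _ _ rP Px QNb Pxb.
  exists (- b1); rewrite opprK; split=> //; first by rewrite /Q /= norm1N.
  (* The shift [b + b1] is the opposite of [- b - b1], which has norm at most 1. *)
  by apply: translate_Q; rewrite -norm1N opprD.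
Qed.
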